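(* Let $R=F_1\oplus\cdots\oplus F_n$ be the decomposition of a finite semi-simple commutative ring $R$ into finite fields $F_i$, with $|F_1|\geq\cdots\geq|F_n|$. For each $i$ let $A_i=\{j:|F_j|=|F_i|\}$. Let $\Pi\leq S_n$ be the set of all permutations $\pi$ of $\{1,\ldots,n\}$ preserving the sets $A_i$ (i.e. $\pi(A_i)=A_i$ for all $i$), and let $\Sigma_i$ be the set of all permutations $\sigma$ of the set $F_i$ such that $\sigma(0)=0$, $\sigma(\{1,-1\})=\{1,-1\}$, and for every $f\in F_i\setminus\{0,1,-1\}$ the set $\sigma(\{f,f^{-1}\})$ is of the form $\{g,g^{-1}\}$ for some $g\in F_i\setminus\{0,1,-1\}$. Then the automorphism group $\mathrm{Aut}(\mathfrak{J}_R)$ is exactly the set of maps $\alpha$ on the vertex set of $\mathfrak{J}_R$ of the form \[\alpha\Big(\sum_{i=1}^{n}a_i\mathbf{e}_i\Big)=\sum_{i=1}^{n}\sigma_i(a_i)\mathbf{e}_{\pi(i)}\] with $\pi\in\Pi$ and $\sigma_i\in\Sigma_i$ for $i=1,\ldots,n$.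
   Context: For a commutative ring $R$ with non-zero identity, $J(R)$ denotes its Jacobson radical and $U(R)$ its group of units. The Jacobson graph $\mathfrak{J}_R$ is the simple graph with vertex set $R\setminus J(R)$ in which two distinct vertices $x,y$ are adjacent if and only if $1-xy\notin U(R)$. $\mathrm{Aut}(\mathfrak{J}_R)$ is its group of graph automorphisms. A ring is semi-simple if $J(R)=0$; so here the vertex set is $R\setminus\{0\}$. The element $\mathbf{e}_i\in R$ has $1$ in its $i$th entry and $0$ elsewhere, and $\sum_i a_i\mathbf{e}_i$ with $a_i\in F_i$ denotes $(a_1,\ldots,a_n)$. Finite fields of the same order among the $F_i$ are identified (taken to be the same field), so that $\sigma_i(a_i)\mathbf{e}_{\pi(i)}$ makes sense when $|F_{\pi(i)}|=|F_i|$. *)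

(* Defs.v *)
From HB Require Import structures.
From mathcomp Require Import all_boot all_order all_algebra all_fingroup.

Set Implicit Arguments.
Unset Strict Implicit.
Unset Printing Implicit Defensive.

Import GRing.Theory.
Local Open Scope ring_scope.

Section JacobsonGraph.

Variable R : finComUnitRingType.

(* A boolean form of the library's [idealr_closed], so that the finitely many
   ideals of [R] can be ranged over; see [is_proper_idealP]. *)
Definition is_proper_ideal (M : {set R}) : bool :=
  [&& 0 \in M, 1 \notin M &
      [forall a, forall x in M, forall y in M, a * x + y \in M]].

Lemma is_proper_idealP (M : {set R}) :
  reflect (idealr_closed M) (is_proper_ideal M).
Proof.
apply: (iffP and3P) => [[M0 M1 MD]|[M0 M1 MD]]; split=> //.
  move=> a x y xM yM.
  by move/forallP/(_ a)/forall_inP/(_ x xM)/forall_inP/(_ y yM): MD.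
apply/forallP=> a; apply/forall_inP=> x xM; apply/forall_inP=> y yM.
exact: MD.
Qed.

Definition is_maximal_ideal (M : {set R}) : bool := maxset is_proper_ideal M.

Definition jacobson_radical : {set R} :=
  \bigcap_(M : {set R} | is_maximal_ideal M) M.

Definition semisimple : bool := jacobson_radical == [set 0].

Definition jacobson_vertex : finType := {x : R | x \notin jacobson_radical}.

Definition jacobson_adj : rel jacobson_vertex :=
  fun x y => (x != y) && (1 - val x * val y \notin GRing.unit).

End JacobsonGraph.

Definition graph_automorphism (V : finType) (e : rel V) (f : V -> V) : Prop :=
  bijective f /\ forall x y, e (f x) (f y) = e x y.

Section Decomposition.

Variables (n : nat) (F : 'I_n -> finFieldType).

(* [R] is the direct sum of the fields [F i], with [p i x] the [i]-th entry of
   [x]; thus [\sum_i a_i e_i] is the [x] such that [p i x = a_i] for all [i]. *)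
Definition is_direct_sum (R : finComUnitRingType)
    (p : forall i, {rmorphism R -> F i}) : Prop :=
  bijective (fun x : R => [ffun i => p i x] : {dffun forall i, F i}).

(* "Fields of the same order are the same field": a coherent system of ring
   (hence field) isomorphisms between them, used in place of equalities
   between types. *)
Record field_identification := FieldIdentification {
  ident : forall i j, #|F i| = #|F j| -> {rmorphism F i -> F j};
  ident_refl : forall i (h : #|F i| = #|F i|) a, ident h a = a;
  ident_trans : forall i j k (hij : #|F i| = #|F j|) (hjk : #|F j| = #|F k|)
    (hik : #|F i| = #|F k|) a, ident hjk (ident hij a) = ident hik a
}.

Definition same_order (i : 'I_n) : {set 'I_n} := [set j | #|F j| == #|F i|].

Definition order_preserving_perms : {set {perm 'I_n}} :=
  [set s : {perm 'I_n} | [forall i, s @: same_order i == same_order i]].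

Lemma order_preserving_card (s : {perm 'I_n}) :
  s \in order_preserving_perms -> forall i, #|F i| = #|F (s i)|.
Proof.
rewrite inE => /forallP sP i.
have: s i \in same_order i by rewrite -(eqP (sP i)) imset_f // inE.
by rewrite inE => /eqP.
Qed.

End Decomposition.

Definition inverse_pair_perms (K : finFieldType) : {set {perm K}} :=
  [set s : {perm K} |
    [&& s 0 == 0, s @: [set 1; -1] == [set 1; -1] &
        [forall f, (f \notin [set 0; 1; -1]) ==>
          [exists g, (g \notin [set 0; 1; -1])
                     && (s @: [set f; f^-1] == [set g; g^-1])]]]].

(* [alpha (\sum_i a_i e_i) = \sum_i sigma_i(a_i) e_(pi i)], read entrywise. *)
Definition acts_entrywise (n : nat) (F : 'I_n -> finFieldType)
    (R : finComUnitRingType) (p : forall i, {rmorphism R -> F i})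
    (io : field_identification F)
    (pi : {perm 'I_n}) (pi_ok : pi \in order_preserving_perms F)
    (sigma : forall i, {perm F i})
    (alpha : jacobson_vertex R -> jacobson_vertex R) : Prop :=
  forall (x : jacobson_vertex R) (i : 'I_n),
    p (pi i) (val (alpha x))
      = ident io (order_preserving_card pi_ok i) (sigma i (p i (val x))).

(* Main.v *)
Require Import Defs.
From mathcomp Require Import all_boot all_order all_algebra all_fingroup.

(* Call [x] and [y] linked when [x_i y_i = 1] for some [i], so that adjacency is
   being linked and distinct, and say that [y] extends [x] when [y_i = x_i]
   whenever [x_i] is nonzero. With loops, [y] would extend [x] exactly when
   every neighbour of [x] is a neighbour of [y]. Without loops this fails only in
   rare cases, which can be recognized from the graph, so for [n > 1] an
   automorphism preserves extension; for [n = 1] this is trivial. Hence it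
   permutes the minimal vertices [a e_i]. Since [a e_i] and [c e_j] have a common
   extension iff [i <> j] or [a = c], it permutes the indices; and since [x] is
   determined by the [a e_i] it extends, it acts entrywise. Adjacency of [a e_i]
   and [c e_i] finally forces the entry maps to commute with inversion. *)

Set Implicit Arguments.
Unset Strict Implicit.
Unset Printing Implicit Defensive.

Import GRing.Theory.

(** * Permutations of a field that commute with inversion *)

Section InversePairPerms.

Local Open Scope ring_scope.

(** In a field, [1] and [-1] are the only nonzero elements equal to their inverse, so [s] carries
    each inverse pair to an inverse pair of the same size. At [a = 0] the convention [0^-1 = 0]
    applies. *)
Lemma inverse_pair_permsP (K : finFieldType) (s : {perm K}) :
  reflect (s 0 = 0 /\ forall a, s a^-1 = (s a)^-1) (s \in inverse_pair_perms K).
Proof.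
have fixV (a : K) : a != 0 -> (a \in [set 1; -1]) = (a^-1 == a).
  move=> a0; rewrite !inE -eqf_sqr expr1n expr2 -(inj_eq (mulfI a0) a^-1).
  by rewrite mulfV // eq_sym.
have fixV0 (a : K) : (a \notin [set 0; 1; -1]) = (a != 0) && (a^-1 != a).
  rewrite !inE -!orbA negb_or; case: eqP => //= /eqP a0.
  by rewrite -(fixV a a0) !inE.
have s2 (f g : K) : s @: [set f; g] = [set s f; s g] by rewrite imsetU1 imset_set1.
apply: (iffP idP) => [|[s0 sV]]; rewrite inE.
  case/and3P=> /eqP s0 /eqP s1 /forallP sf; split=> // a.
  have [->|a0] := eqVneq a 0; first by rewrite s0 invr0 s0.
  have sa0 : s a != 0 by rewrite -s0 (inj_eq perm_inj).
  have [aV|aV] := boolP (a^-1 == a).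
    have : s a \in [set 1; -1] by rewrite -s1 imset_f // fixV.
    by rewrite fixV // (eqP aV) => /eqP ->.
  have /implyP := sf a; rewrite fixV0 a0 aV => /(_ isT) /existsP [g /andP [_ /eqP]].
  rewrite s2 => E.
  have : s a \in [set g; g^-1] by rewrite -E !inE eqxx.
  have : s a^-1 \in [set g; g^-1] by rewrite -E !inE eqxx orbT.
  have : s a^-1 != s a by rewrite (inj_eq perm_inj).
  rewrite !inE => ne /orP[]/eqP E1 /orP[]/eqP E2; move: ne; rewrite E1 E2 ?eqxx //.
  by rewrite invrK.
have sn0 a : a != 0 -> s a != 0 by rewrite -{2}s0 (inj_eq perm_inj).
apply/and3P; split; first by rewrite s0.
  rewrite eqEcard card_imset ?leqnn ?andbT; last exact: perm_inj.
  apply/subsetP=> _ /imsetP [a a1 ->].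
  have a0 : a != 0 by move: a1; rewrite !inE => /orP[]/eqP->; rewrite ?oppr_eq0 oner_eq0.
  by move: a1; rewrite !fixV ?sn0 // => /eqP {1}<-; rewrite sV invrK.
apply/forallP=> f; apply/implyP; rewrite fixV0 => /andP [f0 fV].
apply/existsP; exists (s f).
by rewrite fixV0 sn0 // -sV (inj_eq perm_inj) fV s2 /=.
Qed.

Lemma inverse_pair_perms_mul_eq1 (K : finFieldType) (s : {perm K}) (a b : K) :
  s \in inverse_pair_perms K -> (s a * s b == 1) = (a * b == 1).
Proof.
case/inverse_pair_permsP=> s0 sV.
have [->|a0] := eqVneq a 0; first by rewrite s0 !mul0r.
have sa0 : s a != 0 by rewrite -s0 (inj_eq perm_inj).
(* Writing [1] as [s a / s a] and as [a / a] reduces both equations to [b = a^-1]. *)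
rewrite -[1 in LHS](divff sa0) -[1 in RHS](divff a0) -sV.
by rewrite !(inj_eq (mulfI _)) // (inj_eq perm_inj).
Qed.

End InversePairPerms.

(** * Elements of a direct sum of fields and their entries *)

Section DirectSum.

Local Open Scope ring_scope.

Variables (R : finComUnitRingType) (n : nat) (F : 'I_n -> finFieldType).
Variable p : forall i, {rmorphism R -> F i}.
Hypothesis R_sum : is_direct_sum p.

(** [is_direct_sum] only asserts that an inverse exists, so the element is found by searching the
    finite ring; under that hypothesis the default [0] is never reached. *)
Definition of_entries (f : forall i, F i) : R :=
  odflt 0 [pick x | [forall i, p i x == f i]].

Lemma of_entriesE f i : p i (of_entries f) = f i.
Proof.
rewrite /of_entries; case: pickP => [x /forallP /(_ i) /eqP //|none].
case: R_sum => g _ gK; have /negP[] := none (g [ffun i => f i]).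
apply/forallP=> j.
by move: (congr1 (fun h : {dffun _} => h j) (gK [ffun i => f i])); rewrite !ffunE => ->.
Qed.

Lemma entries_inj x y : (forall i, p i x = p i y) -> x = y.
Proof.
move=> xy; apply: (bij_inj R_sum); apply/ffunP=> i; rewrite !ffunE. exact: xy.
Qed.

Lemma entries_unit x : (x \is a GRing.unit) = [forall i, p i x != 0].
Proof.
apply/idP/forallP => [xu i|x0]; first by rewrite -unitfE rmorph_unit.
apply/unitrPr; exists (of_entries (fun i => (p i x)^-1)).
by apply: entries_inj => i; rewrite rmorphM rmorph1 of_entriesE (mulfV (x0 i)).
Qed.

Lemma entries_neq0 x : x != 0 -> exists i, p i x != 0.
Proof.
move=> x0; apply/existsP; apply: contraNT x0; rewrite negb_exists => /forallP x0.
by apply/eqP/entries_inj => i; rewrite rmorph0; apply/eqP; rewrite -[_ == _]negbK.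
Qed.

Definition single i (a : F i) : R := of_entries (dfwith (fun j => 0 : F j) a).

Lemma single_in i (a : F i) : p i (single a) = a.
Proof. by rewrite of_entriesE dfwith_in. Qed.

Lemma single_out i j (a : F i) : i != j -> p j (single a) = 0.
Proof. by move=> ij; rewrite of_entriesE dfwith_out. Qed.

Lemma single0 i : single (0 : F i) = 0.
Proof.
apply: entries_inj => j; rewrite rmorph0.
by have [<-|ij] := eqVneq i j; rewrite ?single_in ?single_out.
Qed.

Lemma single_eq0 i (a : F i) : (single a == 0) = (a == 0).
Proof.
apply/eqP/eqP => [a0|->]; last exact: single0.
by rewrite -(single_in a) a0 rmorph0.
Qed.

(** * Recovering extension from adjacency *)

Definition linked x y := [exists i, p i x * p i y == 1].

Definition adj x y := (x != y) && linked x y.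

Lemma linkedC x y : linked x y = linked y x.
Proof. by apply: eq_existsb => i; rewrite mulrC. Qed.

Definition restricts x y := [forall i, (p i x != 0) ==> (p i y == p i x)].

Lemma restrictsP x y :
  reflect (forall i, p i x != 0 -> p i y = p i x) (restricts x y).
Proof.
apply: (iffP forallP) => xy i; first by move=> xi; apply/eqP/(implyP (xy i)).
by apply/implyP=> xi; rewrite xy.
Qed.

Lemma single_restricts i (a : F i) x :
  a != 0 -> restricts (single a) x = (p i x == a).
Proof.
move=> a0; apply/restrictsP/eqP => [/(_ i)|xi j]; first by rewrite single_in; apply.
have [<-|ij] := eqVneq i j; first by rewrite single_in xi.
by rewrite single_out // eqxx.
Qed.

Lemma restricts_linkedr x y z : restricts x y -> linked z x -> linked z y.
Proof.
move=> /restrictsP xy /existsP [i /eqP zx]; apply/existsP; exists i; rewrite xy ?zx //.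
by apply/eqP=> x0; move/eqP: zx; rewrite x0 mulr0 eq_sym oner_eq0.
Qed.

(** Built from equality and adjacency alone, hence preserved by automorphisms. The vertices [x] and
    [y] are left out as values of [z] because the graph has no loops. *)
Definition dominated x y :=
  [forall z, [&& z != x, z != y & adj z x] ==> adj z y].

Lemma dominatedP x y :
  reflect (forall z, z != x -> z != y -> linked z x -> linked z y) (dominated x y).
Proof.
apply: (iffP forallP) => xy z.
  move=> zx zy lzx; move/implyP: (xy z); rewrite /adj zx zy lzx.
  by apply.
by apply/implyP => /and3P [zx zy /andP [_ lzx]]; rewrite /adj zy xy.
Qed.

Lemma restricts_dominated x y : restricts x y -> dominated x y.
Proof. by move=> xy; apply/dominatedP=> z _ _; apply: restricts_linkedr. Qed.

(** An accidental domination forces [x = a e_i] with [a^2 = 1]: such an [x] is linked to itself,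
    which the graph does not show. Adding [e_j] to [x] turns this hidden loop into an edge. *)
Lemma dominated_not_restricts x y :
    (1 < n)%N -> dominated x y -> ~~ restricts x y ->
  ~~ adj x y /\ exists2 w, dominated x w & adj x w.
Proof.
move=> n1 /dominatedP xy; rewrite negb_forall => /existsP [i].
rewrite negb_imply => /andP [xi yi].
(* Such a [z] is linked to [x] at index [i] but not linked to [y], so domination leaves only the two
   excluded vertices. *)
have inZ z : p i z = (p i x)^-1 -> (forall j, i != j -> p j z * p j y != 1) ->
    z = x \/ z = y.
  move=> zi zy; have [->|zx] := eqVneq z x; first by left.
  have [->|nzy] := eqVneq z y; first by right.
  have /existsP [j] : linked z y.
    by apply: xy => //; apply/existsP; exists i; rewrite zi mulVf.
  have [<-|ij] := eqVneq i j; last by rewrite (negPf (zy _ ij)).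
  by rewrite zi -(divff xi) mulrC (inj_eq (mulIf _)) ?invr_eq0 // (negPf yi).
have [j ij] : exists j, i != j.
  have n0 : (0 < n)%N by exact: ltnW.
  have [->|i0] := eqVneq i (Ordinal n0); last by exists (Ordinal n0).
  by exists (Ordinal n1).
have ji : j != i by rewrite eq_sym.
have [E|E] : single (p i x)^-1 = x \/ single (p i x)^-1 = y.
- apply: inZ => [|k ik]; first by rewrite single_in.
  by rewrite single_out // mul0r eq_sym oner_eq0.
(* Here [x] is its own inverse at [i] and zero elsewhere; [w = x + e_j] extends it. *)
- have xV : (p i x)^-1 = p i x by rewrite -{2}E single_in.
  split.
    rewrite negb_and; apply/orP; right; apply/existsP=> [[k]].
    have [<-|ik] := eqVneq i k; last first.
      by rewrite -E single_out // mul0r eq_sym oner_eq0.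
    rewrite -(divff xi) (inj_eq (mulfI xi)) xV; exact/negP.
  have xw : restricts x (x + single (1 : F j)).
    rewrite -{1}E single_restricts ?invr_eq0 // rmorphD single_out // addr0.
    by rewrite xV.
  exists (x + single (1 : F j)); first exact: restricts_dominated.
  rewrite /adj (restricts_linkedr xw) ?andbT.
    by rewrite -{1}[x]addr0 (inj_eq (addrI x)) eq_sym single_eq0 oner_eq0.
  by apply/existsP; exists i; rewrite -{2}xV divff.
(* Impossible case: [y] vanishes outside [i], so adding [e_j] gives a second test element, which is
   neither [x] nor [y]. *)
- have [] : single (p i x)^-1 + single (1 : F j) = x
         \/ single (p i x)^-1 + single (1 : F j) = y.
  + apply: inZ => [|k ik]; first by rewrite rmorphD single_in single_out // addr0.
    by rewrite -E (single_out _ ik) mulr0 eq_sym oner_eq0.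
  + move=> Ex; case/eqP: yi; rewrite -E single_in -{2}Ex rmorphD single_in.
    by rewrite single_out // addr0.
  + move=> /eqP; rewrite -E -{2}[single _]addr0 (inj_eq (addrI _)).
    by rewrite single_eq0 oner_eq0.
Qed.

(* The second condition excludes the accidental dominations caused by the
   absence of loops, as when [x = e_i] and every other field is [F_2]. *)
Lemma restrictsE x y : (1 < n)%N ->
  restricts x y =
    dominated x y &&
      [forall w, dominated x w && adj x w ==> (x == y) || adj x y].
Proof.
move=> n1; apply/idP/andP => [xy|[dxy /forallP adjxy]].
  split; first exact: restricts_dominated.
  apply/forallP=> w; apply/implyP=> /andP [dxw axw].
  (* It remains to link [x] to itself: [w] extends [x] and is adjacent to it, so [x_i^2 = 1] for
     some [i]. *)
  rewrite /adj; case: eqP => //= _; apply: (restricts_linkedr xy).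
  have [xw|nxw] := boolP (restricts x w); last first.
    by have [] := dominated_not_restricts n1 dxw nxw; rewrite axw.
  case/andP: axw => _ /existsP [i xwi]; apply/existsP; exists i.
  have xi : p i x != 0.
    by apply: contraTneq xwi => ->; rewrite mul0r eq_sym oner_eq0.
  by rewrite -{2}(restrictsP _ _ xw i xi).
have [//|nxy] := boolP (restricts x y).
have [naxy [w dxw axw]] := dominated_not_restricts n1 dxy nxy.
have := adjxy w; rewrite dxw axw (negPf naxy) orbF /= => /eqP xy.
by case/negP: nxy; apply/restrictsP=> i _; rewrite xy.
Qed.

(** With at most one index, a nonzero element has no zero entry. The resulting form is preserved by
    every injection fixing [0], without recourse to adjacency. *)
Lemma restrictsE1 x y : (n <= 1)%N -> restricts x y = (x == 0) || (x == y).
Proof.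
move=> n1; have eqi (i j : 'I_n) : i = j.
  apply/val_inj; case: i j => [i lti] [j ltj] /=.
  have := leq_trans lti n1; have := leq_trans ltj n1.
  by case: i j {lti ltj} => [|?] [|?].
apply/idP/orP => [/restrictsP xy|[]/eqP->]; last 2 first.
- by apply/restrictsP=> i; rewrite rmorph0 eqxx.
- exact/restrictsP.
have [->|x0] := eqVneq x 0; [by left|right].
have [i xi] := entries_neq0 x0.
by apply/eqP/entries_inj => j; rewrite -(eqi i j) xy.
Qed.

(** * Minimal nonzero elements for extension *)

Definition atom x :=
  (x != 0) && [forall y, restricts y x ==> (y == 0) || (y == x)].

Lemma single_sub_restricts i (a : F i) y :
  y != 0 -> restricts y (single a) -> y = single a.
Proof.
move=> y0 /restrictsP ya.
have yout j : i != j -> p j y = 0.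
  move=> ij; apply/eqP/negPn/negP=> yj; case/eqP: (yj).
  by rewrite -(ya j yj) single_out.
have [k yk] := entries_neq0 y0.
have ik : i = k by apply/eqP; apply: contraNT yk => /yout ->.
case: k / ik yk => yi; apply: entries_inj => j.
by have [<-|ij] := eqVneq i j; [rewrite ya | rewrite yout ?single_out].
Qed.

Lemma atomP x : reflect (exists i (a : F i), a != 0 /\ x = single a) (atom x).
Proof.
apply: (iffP andP) => [[x0 /forallP xmin]|[i [a [a0 ->]]]].
  have [i xi] := entries_neq0 x0; exists i, (p i x); split=> //.
  have := xmin (single (p i x)); rewrite single_restricts // eqxx single_eq0.
  by rewrite (negPf xi) /= => /eqP.
rewrite single_eq0; split=> //; apply/forallP=> y; apply/implyP=> ya.
by case: eqVneq => //= y0; rewrite (single_sub_restricts y0 ya).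
Qed.

(** * Automorphisms, extended to the whole ring by fixing [0] *)

Section Automorphism.

Variable b : R -> R.
Hypothesis b_inj : injective b.
Hypothesis b0 : b 0 = 0.
Hypothesis b_adj : forall x y, adj (b x) (b y) = adj x y.

Lemma b_surj y : exists x, y = b x.
Proof. by have [g _ bK] := injF_bij b_inj; exists (g y); rewrite bK. Qed.

Lemma forallb_automorphism (P : pred R) : [forall z, P (b z)] = [forall z, P z].
Proof.
apply/forallP/forallP => H z; last exact: H.
by have [x ->] := b_surj z.
Qed.

Lemma automorphism_eq0 x : (b x == 0) = (x == 0).
Proof. by rewrite -{1}b0 (inj_eq b_inj). Qed.

Lemma automorphism_dominated x y : dominated (b x) (b y) = dominated x y.
Proof.
rewrite /dominated -forallb_automorphism; apply: eq_forallb => z.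
by rewrite !b_adj !(inj_eq b_inj).
Qed.

Lemma automorphism_restricts x y : restricts (b x) (b y) = restricts x y.
Proof.
have [n1|n1] := leqP n 1.
  by rewrite !restrictsE1 // automorphism_eq0 (inj_eq b_inj).
rewrite !restrictsE // automorphism_dominated; congr (_ && _).
rewrite -forallb_automorphism; apply: eq_forallb => z.
by rewrite automorphism_dominated !b_adj !(inj_eq b_inj).
Qed.

Lemma automorphism_atom x : atom (b x) = atom x.
Proof.
rewrite /atom automorphism_eq0 -forallb_automorphism; congr (_ && _).
apply: eq_forallb => z.
by rewrite automorphism_restricts automorphism_eq0 (inj_eq b_inj).
Qed.

Lemma automorphism_single i (a : F i) :
  a != 0 -> exists j (c : F j), c != 0 /\ b (single a) = single c.
Proof.
by move=> a0; apply/atomP; rewrite automorphism_atom; apply/atomP; exists i, a.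
Qed.

Lemma restricts_sum i j (a : F i) (c : F j) : i != j -> a != 0 -> c != 0 ->
  restricts (single a) (single a + single c) &&
  restricts (single c) (single a + single c).
Proof.
move=> ij a0 c0; have ji : j != i by rewrite eq_sym.
rewrite !single_restricts // !rmorphD !single_in.
by rewrite (single_out _ ij) (single_out _ ji) addr0 add0r !eqxx.
Qed.

(* Two distinct atoms have a common extension exactly when they are supported
   at different indices, so [b] maps atoms with a common index to atoms with a
   common index. *)
Lemma automorphism_index i :
  exists j, forall a : F i, b (single a) = single (p j (b (single a))).
Proof.
have [j [c [c0 bi]]] := automorphism_single (oner_neq0 (F i)).
exists j => a; have [->|a0] := eqVneq a 0.
  by rewrite single0 b0 rmorph0 single0.
have [k [d [d0 bk]]] := automorphism_single a0.
have [jk|jk] := eqVneq j k; first by case: k / jk d d0 bk => d d0 ->; rewrite single_in.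
(* If the images had distinct indices, the preimage [u] of their common extension would have [i]-th
   entry both [1] and [a]; but for [a = 1] the claim holds by the choice of [j]. *)
have /andP [] := restricts_sum jk c0 d0.
have [u ->] := b_surj (single c + single d).
rewrite -bi -bk !automorphism_restricts !single_restricts // ?oner_eq0 //.
by move=> /eqP -> /eqP a1; rewrite -a1 bi single_in.
Qed.

Lemma automorphism_entries :
  exists (pi : {perm 'I_n}) (s : forall i, F i -> F (pi i)),
    (forall i, bijective (s i)) /\
    (forall x i, p (pi i) (b x) = s i (p i x)).
Proof.
have [f fE] := fin_all_exists automorphism_index.
pose s i (a : F i) : F (f i) := p (f i) (b (single a)).
have s0 i : s i 0 = 0 by rewrite /s single0 b0 rmorph0.
have s_inj i : injective (s i).
  move=> a c E; rewrite -(single_in a) -(single_in c); congr (p i _).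
  by apply: b_inj; rewrite fE -/(s i a) E -fE.
have s_neq0 i a : a != 0 -> s i a != 0 by rewrite -(s0 i) (inj_eq (@s_inj i)).
have f_inj : injective f.
  (* The image of [e_i + e_k] extends the images of [e_i] and [e_k]. At a common index these would
     coincide, against injectivity of [b]. *)
  move=> i k fik; apply/eqP/negPn/negP => ik.
  have /andP [] := restricts_sum ik (oner_neq0 (F i)) (oner_neq0 (F k)).
  rewrite -!(automorphism_restricts _ (_ + _)); set u := b (_ + _).
  rewrite (fE i) (fE k) -/(s i 1) -/(s k 1).
  (* Generalizing [s k 1] allows elimination of [f i = f k], which puts both values in the same
     field. *)
  have := s_neq0 k _ (oner_neq0 (F k)); have := fE k 1; rewrite -/(s k 1).
  move: (s k 1); case: (f k) / fik => c bk c0.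
  rewrite !single_restricts ?s_neq0 ?oner_neq0 // => /eqP -> /eqP ck.
  move: bk; rewrite -ck -fE => /b_inj /(congr1 (p k)).
  by rewrite single_in single_out // => /eqP; rewrite oner_eq0.
have s_surj i c : c != 0 -> exists2 a, a != 0 & single c = b (single a) :> R /\ c = s i a.
  move=> c0; have [u Eu] := b_surj (single c).
  have /atomP [k [a [a0 Ea]]] : atom u.
    by rewrite -automorphism_atom -Eu; apply/atomP; exists (f i), c.
  move: Eu; rewrite Ea => Eu.
  have ki : k = i.
    apply/f_inj/eqP/negPn/negP => fki; case/eqP: c0.
    by rewrite -(single_in c) Eu fE single_out.
  case: i / ki c Eu {c0} => c Eu; exists a => //; split=> //.
  by rewrite /s -Eu single_in.
exists (perm f_inj).
have pE i : perm f_inj i = f i by rewrite permE.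
(* [perm f_inj i] and [f i] are only provably equal, so the values of [s i] are transported. *)
exists (fun i a => ecast j (F j) (esym (pE i)) (s i a)); split=> [i|x i].
  case: (perm f_inj i) / (esym (pE i)) => /=.
  apply: inj_card_bij; first exact: s_inj.
  rewrite -(card_imset _ (@s_inj i)) subset_leq_card //; apply/subsetP=> c _.
  have [->|/s_surj [a _ [_ ->]]] := eqVneq c 0; last exact: imset_f.
  by rewrite -(s0 i) imset_f.
case: (perm f_inj i) / (esym (pE i)) => /=.
have [xi|xi] := eqVneq (p i x) 0; last first.
  have : restricts (single (p i x)) x by rewrite single_restricts.
  rewrite -automorphism_restricts fE -/(s i _) single_restricts ?s_neq0 //.
  by move/eqP.
(* A nonzero entry of [b x] at [f i] would make [b x] extend some [b (a e_i)] with [a] nonzero, so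
   [x_i = a], contradicting [x_i = 0]. *)
rewrite xi s0; apply/eqP/negPn/negP => /[dup] c0 /s_surj [a a0 [E _]].
have : restricts (single (p (f i) (b x))) (b x) by rewrite single_restricts.
rewrite E automorphism_restricts single_restricts // xi eq_sym => a00.
by rewrite a00 in a0.
Qed.

Lemma automorphism_entries_inv (pi : {perm 'I_n}) (s : forall i, F i -> F (pi i)) :
    (forall x i, p (pi i) (b x) = s i (p i x)) -> (forall i, bijective (s i)) ->
  forall i, s i 0 = 0 /\ forall a, s i a^-1 = (s i a)^-1.
Proof.
move=> bE s_bij i.
have s0 j : s j 0 = 0 by rewrite -(rmorph0 (p j)) -bE b0 rmorph0.
split=> // a; have [->|a0] := eqVneq a 0; first by rewrite invr0 s0 invr0.
have s_inj := bij_inj (s_bij i).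
have bs (c : F i) : b (single c) = single (s i c).
  apply: entries_inj => j; have [k ->] : exists k, j = pi k.
    by exists ((pi^-1)%g j); rewrite permKV.
  rewrite bE; have [<-|ik] := eqVneq i k; first by rewrite !single_in.
  by rewrite !single_out ?s0 // (inj_eq perm_inj).
have adj_single k (c d : F k) : adj (single c) (single d) = (c != d) && (c * d == 1).
  congr (~~ _ && _).
    by apply/eqP/eqP => [cd|-> //]; rewrite -(single_in c) cd single_in.
  apply/existsP/idP => [[j]|cd]; last by exists k; rewrite !single_in.
  have [<-|kj] := eqVneq k j; first by rewrite !single_in.
  by rewrite single_out // mul0r eq_sym oner_eq0.
have mul1 c d : c != d -> (s i c * s i d == 1) = (c * d == 1).
  move=> cd; have := b_adj (single c) (single d).
  by rewrite !bs !adj_single (inj_eq s_inj) cd.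
have sa0 : s i a != 0 by rewrite -(s0 i) (inj_eq s_inj).
apply: (mulfI sa0); rewrite mulfV //.
have [aV|aV] := eqVneq a a^-1; last by apply/eqP; rewrite mul1 // mulfV.
have [g _ gK] := s_bij i.
(* Adjacency says nothing about the pair [(a, a)] when [a = a^-1]. Instead, let [g] send the inverse
   of [s i a] back: a result other than [a] would give an edge, hence an inverse of [a] different
   from [a]. *)
have [E|E] := eqVneq a (g (s i a)^-1); first by rewrite -aV {2}E gK mulfV.
have := mul1 _ _ E; rewrite gK mulfV // eqxx => /esym /eqP ag.
case/eqP: E; rewrite [LHS]aV; apply: (mulfI a0); rewrite ag mulfV //.
Qed.

End Automorphism.

End DirectSum.

(** * Passing between the vertex set and the ring *)

Section JacobsonGraph.

Local Open Scope ring_scope.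

Variables (R : finComUnitRingType) (n : nat) (F : 'I_n -> finFieldType).
Variable p : forall i, {rmorphism R -> F i}.
Hypothesis R_semisimple : semisimple R.
Hypothesis R_sum : is_direct_sum p.

Lemma jacobson_vertexE (x : R) : (x \notin jacobson_radical R) = (x != 0).
Proof. by rewrite (eqP R_semisimple) inE. Qed.

Lemma jacobson_vertex_neq0 (x : jacobson_vertex R) : val x != 0.
Proof. by rewrite -jacobson_vertexE; exact: (svalP x). Qed.

Lemma jacobson_adjE (x y : jacobson_vertex R) :
  jacobson_adj x y = adj p (val x) (val y).
Proof.
rewrite /jacobson_adj /adj (inj_eq val_inj) (entries_unit R_sum) negb_forall.
congr (_ && _); apply: eq_existsb => i.
by rewrite negbK rmorphB rmorphM rmorph1 subr_eq0 eq_sym.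
Qed.

Lemma adj0 x : adj p 0 x = false.
Proof.
apply/negP=> /andP [_ /existsP [i]].
by rewrite rmorph0 mul0r eq_sym oner_eq0.
Qed.

(** Adding [0] as a fixed point keeps adjacency, since [0] has no neighbour, and makes all entry
    vectors available without subtype proofs. *)
Definition extend_by0 (alpha : jacobson_vertex R -> jacobson_vertex R) (x : R) : R :=
  oapp (val \o alpha) 0 (insub x).

Section Extension.

Variable alpha : jacobson_vertex R -> jacobson_vertex R.

Lemma extend_by0_val x : extend_by0 alpha (val x) = val (alpha x).
Proof. by rewrite /extend_by0 valK. Qed.

Lemma extend_by0_0 : extend_by0 alpha 0 = 0.
Proof. by rewrite /extend_by0 insubN // jacobson_vertexE eqxx. Qed.

Variant vertex_or0 : R -> Prop :=
  | IsZero : vertex_or0 0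
  | IsVertex (v : jacobson_vertex R) : vertex_or0 (val v).

Lemma vertex_or0P x : vertex_or0 x.
Proof.
have [->|x0] := eqVneq x 0; first exact: IsZero.
have xv : x \notin jacobson_radical R by rewrite jacobson_vertexE.
exact: (IsVertex (Sub x xv : jacobson_vertex R)).
Qed.

Lemma extend_by0_inj : injective alpha -> injective (extend_by0 alpha).
Proof.
move=> alpha_inj x y.
case: (vertex_or0P x) => [|v]; case: (vertex_or0P y) => [|w] //;
  rewrite ?extend_by0_0 ?extend_by0_val.
- by move/esym/eqP; rewrite (negPf (jacobson_vertex_neq0 _)).
- by move/eqP; rewrite (negPf (jacobson_vertex_neq0 _)).
- by move=> /val_inj /alpha_inj ->.
Qed.

Lemma extend_by0_adj :
    (forall x y, jacobson_adj (alpha x) (alpha y) = jacobson_adj x y) ->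
  forall x y, adj p (extend_by0 alpha x) (extend_by0 alpha y) = adj p x y.
Proof.
move=> alpha_adj x y.
have adjC u v : adj p u v = adj p v u by rewrite /adj eq_sym linkedC.
case: (vertex_or0P x) => [|v]; first by rewrite extend_by0_0 !adj0.
case: (vertex_or0P y) => [|w]; first by rewrite extend_by0_0 !(adjC _ 0) !adj0.
by rewrite !extend_by0_val -!jacobson_adjE.
Qed.

End Extension.

Variable io : field_identification F.

Lemma identK i j (hij : #|F i| = #|F j|) (hji : #|F j| = #|F i|) :
  cancel (ident io hij) (ident io hji).
Proof. by move=> a; rewrite (ident_trans io _ _ (erefl #|F i|)) ident_refl. Qed.

Lemma order_preserving_permsP (pi : {perm 'I_n}) :
  (forall i, #|F i| = #|F (pi i)|) -> pi \in order_preserving_perms F.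
Proof.
move=> piF; rewrite inE; apply/forallP=> i.
rewrite eqEcard card_imset ?leqnn ?andbT; last exact: perm_inj.
by apply/subsetP=> _ /imsetP [j + ->]; rewrite !inE -piF.
Qed.

Lemma automorphism_acts_entrywise alpha :
    graph_automorphism (@jacobson_adj R) alpha ->
  exists (pi : {perm 'I_n}) (pi_ok : pi \in order_preserving_perms F)
         (sigma : forall i, {perm F i}),
    (forall i, sigma i \in inverse_pair_perms (F i)) /\
    acts_entrywise p io pi_ok sigma alpha.
Proof.
case=> /bij_inj/extend_by0_inj b_inj /extend_by0_adj b_adj.
have b0 := extend_by0_0 alpha.
have [pi [s [s_bij bE]]] := automorphism_entries R_sum b_inj b0 b_adj.
have s_inv := automorphism_entries_inv R_sum b0 b_adj bE s_bij.
have pi_ok : pi \in order_preserving_perms F.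
  by apply: order_preserving_permsP => i; apply: bij_eq_card (s_bij i).
(* The map [s i] lands in [F (pi i)]; the identification brings its values back to [F i] and, being
   a field morphism, respects [0] and inverses. *)
pose t i := ident io (esym (order_preserving_card pi_ok i)) \o s i.
have t_inj i : injective (t i) by apply: inj_comp (fmorph_inj _) (bij_inj (s_bij i)).
exists pi, pi_ok, (fun i => perm (@t_inj i)); split=> [i|x i].
  have [s0 sV] := s_inv i; apply/inverse_pair_permsP; split=> [|a].
    by rewrite permE /t /= s0 rmorph0.
  by rewrite !permE /t /= sV fmorphV.
by rewrite permE /t /= identK -extend_by0_val bE.
Qed.

(** * Automorphisms built from index permutations and entry maps *)

Section Action.

Variables (pi : {perm 'I_n}) (pi_ok : pi \in order_preserving_perms F).
Variable sigma : forall i, {perm F i}.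
Hypothesis sigma_ok : forall i, sigma i \in inverse_pair_perms (F i).

Lemma acts_entrywise_automorphism alpha :
  acts_entrywise p io pi_ok sigma alpha ->
  graph_automorphism (@jacobson_adj R) alpha.
Proof.
move=> alphaE; have alpha_inj : injective alpha.
  move=> x y xy; apply/val_inj/(entries_inj R_sum) => i.
  apply/(@perm_inj _ (sigma i))/(fmorph_inj (ident io (order_preserving_card pi_ok i))).
  by rewrite -!alphaE xy.
split=> [|x y]; first exact: injF_bij.
rewrite !jacobson_adjE /adj !(inj_eq val_inj) (inj_eq alpha_inj); congr (_ && _).
have E i : (p (pi i) (val (alpha x)) * p (pi i) (val (alpha y)) == 1)
         = (p i (val x) * p i (val y) == 1).
  by rewrite !alphaE -rmorphM fmorph_eq1 inverse_pair_perms_mul_eq1.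
apply/existsP/existsP => [[j]|[i]]; last by exists (pi i); rewrite E.
by rewrite -(permKV pi j) E; exists ((pi^-1)%g j).
Qed.

Lemma acts_entrywise_exists :
  exists alpha, acts_entrywise p io pi_ok sigma alpha.
Proof.
have card_piV j : #|F ((pi^-1)%g j)| = #|F j|.
  by rewrite (order_preserving_card pi_ok) permKV.
pose b x := of_entries p (fun j => ident io (card_piV j)
                                  (sigma ((pi^-1)%g j) (p ((pi^-1)%g j) x))).
have bE x i : p (pi i) (b x) = ident io (order_preserving_card pi_ok i) (sigma i (p i x)).
  (* The two identifications differ only in their proofs of an equality of natural numbers, and such
     proofs are unique. *)
  rewrite of_entriesE //; move: (card_piV (pi i)) (order_preserving_card pi_ok i).
  by rewrite permK => h h'; rewrite (eq_irrelevance h h').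
have b_vertex (x : jacobson_vertex R) : b (val x) \notin jacobson_radical R.
  have [i xi] := entries_neq0 R_sum (jacobson_vertex_neq0 x).
  rewrite jacobson_vertexE; apply: contraNneq xi => bx.
  have [s0 _] := inverse_pair_permsP _ (sigma_ok i).
  have := bE (val x) i; rewrite bx rmorph0 => /esym /eqP; rewrite fmorph_eq0.
  by rewrite -[X in _ == X]s0 (inj_eq perm_inj).
by exists (fun x => Sub (b (val x)) (b_vertex x)) => x i; rewrite SubK bE.
Qed.

End Action.

End JacobsonGraph.

(* The second conjunct says that every pair (pi, sigma) does define a map on
   the vertex set. *)
Theorem theorem3p3 (R : finComUnitRingType) (n : nat)
    (F : 'I_n -> finFieldType) (p : forall i, {rmorphism R -> F i})
    (io : field_identification F)
    (R_semisimple : semisimple R)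
    (R_sum : is_direct_sum p)
    (F_decreasing : forall i j : 'I_n, i <= j -> #|F j| <= #|F i|) :
  (forall alpha : jacobson_vertex R -> jacobson_vertex R,
     graph_automorphism (@jacobson_adj R) alpha <->
     exists (pi : {perm 'I_n}) (pi_ok : pi \in order_preserving_perms F)
            (sigma : forall i, {perm F i}),
       (forall i, sigma i \in inverse_pair_perms (F i)) /\
       acts_entrywise p io pi_ok sigma alpha) /\
  (forall (pi : {perm 'I_n}) (pi_ok : pi \in order_preserving_perms F)
          (sigma : forall i, {perm F i}),
     (forall i, sigma i \in inverse_pair_perms (F i)) ->
     exists alpha : jacobson_vertex R -> jacobson_vertex R,
       acts_entrywise p io pi_ok sigma alpha).
Proof.
split=> [alpha|pi pi_ok sigma sigma_ok]; last exact: acts_entrywise_exists.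
split; first exact: automorphism_acts_entrywise.
by case=> pi [pi_ok [sigma [sigma_ok]]]; apply: acts_entrywise_automorphism.
Qed.
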